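(* Assume the Linearization Conjecture and the Torus Conjecture (both stated in the context, for the given $n$ and $L$). Let $\mu=(\mu^{(1)},\ldots,\mu^{(n)})$ satisfy $p^{(a)}_i\ge1$ for all $(a,i)\in\overline H$, let $\boldsymbol\gamma=(\gamma^{(a)}_i)_{(a,i)\in\overline H}$ with each $\gamma^{(a)}_i$ a common divisor of $m^{(a)}_i$ and $p^{(a)}_i$, and let $1\le r\le n$, $l\ge1$. Let $F_{\boldsymbol\gamma}[bj]$ (resp. $F[bj]$) be the $g\times g$ matrix obtained from $F_{\boldsymbol\gamma}$ (resp. $F$) by replacing its $(b,j)$th column by $h^{(r)}_l$. Then for every path $p\in{\mathcal P}_{\boldsymbol\gamma}(\mu)$ the dynamical period of $p$ under $T^{(r)}_l$ (the smallest positive integer ${\mathcal N}$ with $(T^{(r)}_l)^{\mathcal N}(p)=p$) equals $${\mathcal N}^{(r)}_l=\mathrm{LCM}\left(\frac{\det F_{\boldsymbol\gamma}}{\det F_{\boldsymbol\gamma}[bj]}\right)_{(b,j)\in\overline H}=\mathrm{LCM}\left(\frac{\det F}{\gamma^{(b)}_j\det F[bj]}\right)_{(b,j)\in\overline H},$$ where the $\mathrm{LCM}$ is taken only over those $(b,j)$ with $\det F[bj]\ne0$.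
   Context: For nonzero rational numbers $r_1,\ldots,r_s$, $\mathrm{LCM}(r_1,\ldots,r_s)$ is the smallest positive element of ${\mathbb Z}\cap r_1{\mathbb Z}\cap\cdots\cap r_s{\mathbb Z}$. Fix integers $n\ge 1$, $L\ge 1$. For $1\le r\le n$, $l\ge 1$, let $B^{r,l}$ be the set of semistandard tableaux of rectangular shape with $r$ rows and $l$ columns and entries in $\{1,\ldots,n+1\}$; so $B^{1,1}=\{1,\ldots,n+1\}$. For a semistandard tableau $T$ and a letter $x$, $T\leftarrow x$ denotes Schensted row insertion ($x$ bumps the smallest entry of the first row strictly larger than $x$, the bumped entry is inserted into the next row, and so on; if there is no such entry the letter is appended at the end of the row), and $x\rightarrow T$ denotes column insertion ($x$ bumps the smallest entry of the first column that is $\ge x$, the bumped entry is inserted into the next column, and so on; if there is no such entry the letter is appended at the bottom of the column). The combinatorial $R$ is the bijection $R:B^{r,l}\otimes B^{1,1}\to B^{1,1}\otimes B^{r,l}$ ($\otimes$ is a formal Cartesian product) determined by $R(b\otimes c)=c'\otimes b'$ iff $(c\rightarrow b)=(b'\leftarrow c')$; we also write $b\otimes c\simeq c'\otimes b'$. The local energy $H(b\otimes c)$ is $0$ if this common tableau has shape $(l+1,l^{r-1})$ and $1$ if it has shape $(l^r,1)$. A path is an element $p=b_1\otimes\cdots\otimes b_L$ of $B=(B^{1,1})^{\otimes L}$, also written as a word $b_1\ldots b_L$. For $v\in B^{r,l}$ put $v_0=v$ and recursively $v_{k-1}\otimes b_k\simeq b'_k\otimes v_k$, $e_k=H(v_{k-1}\otimes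 b_k)$ for $k=1,\ldots,L$; write $v'(v;p)=v_L$, $p'(v;p)=b'_1\otimes\cdots\otimes b'_L$, $e_k(v;p)=e_k$. The path $p$ is $T^{(r)}_l$-evolvable if there is $v\in B^{r,l}$ with $v=v'(v;p)$ and, moreover, $p'(v;p)$ and all $e_k(v;p)$ are the same for all such $v$. Then $T^{(r)}_l(p)=p'(v;p)$ and $E^{(r)}_l(p)=\sum_{k=1}^L e_k(v;p)$. A path is evolvable if it is $T^{(r)}_l$-evolvable for all $1\le r\le n$, $l\ge1$. For an $n$-tuple of Young diagrams $\mu=(\mu^{(1)},\ldots,\mu^{(n)})$, let $l^{(a)}_1>\cdots>l^{(a)}_{g_a}\ge 1$ be the distinct row lengths of $\mu^{(a)}$ and $m^{(a)}_i\ge1$ the number of rows of length $l^{(a)}_i$. Put $\overline H=\{(a,i)\mid 1\le a\le n,\ 1\le i\le g_a\}$, $g=|\overline H|$. Let $(C_{ab})_{1\le a,b\le n}$, $C_{ab}=2\delta_{ab}-\delta_{a,b+1}-\delta_{a,b-1}$, be the Cartan matrix of $A_n$. The vacancy numbers are $p^{(a)}_i=L\delta_{a1}-\sum_{(b,j)\in\overline H}C_{ab}\min(l^{(a)}_i,l^{(b)}_j)m^{(b)}_j$. The $g\times g$ matrix $F=(F_{ai,bj})$ is $F_{ai,bj}=\delta_{ab}\delta_{ij}p^{(a)}_i+C_{ab}\min(l^{(a)}_i,l^{(b)}_j)m^{(b)}_j$, and for $\boldsymbol\gamma=(\gamma^{(a)}_i)_{(a,i)\in\overline H}$, with each $\gamma^{(a)}_i$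 a common divisor of $m^{(a)}_i$ and $p^{(a)}_i$, $F_{\boldsymbol\gamma}=(F_{ai,bj}/\gamma^{(b)}_j)$. Put $h^{(r)}_l=(\delta_{rb}\min(l,l^{(b)}_j))_{(b,j)\in\overline H}\in{\mathbb Z}^g$. A path is highest if for every $1\le j\le L$ the prefix $b_1\ldots b_j$ satisfies $\#(1)\ge\#(2)\ge\cdots\ge\#(n+1)$, where $\#(a)$ is the number of letters $a$. ${\mathcal P}(\mu)$ is the set of evolvable paths $p$ with $\#(1)\ge\#(2)\ge\cdots\ge\#(n+1)$ and $E^{(a)}_l(p)=\sum_{i=1}^{g_a}\min(l,l^{(a)}_i)m^{(a)}_i$ for all $1\le a\le n$, $l\ge1$; ${\mathcal P}_+(\mu)$ is the set of highest paths in ${\mathcal P}(\mu)$. A rigged configuration $(\mu,{\bf r})$ is $\mu$ with an integer array ${\bf r}=(r^{(a)}_{i,\alpha})$, $(a,i)\in\overline H$, $1\le\alpha\le m^{(a)}_i$, with $0\le r^{(a)}_{i,1}\le\cdots\le r^{(a)}_{i,m^{(a)}_i}\le p^{(a)}_i$; $\mathrm{RC}(\mu)$ is the set of these. It is viewed as a multiset of strings (color $a$, length $l^{(a)}_i$, rigging $r^{(a)}_{i,\alpha}$). A string is singular if its rigging equals the vacancy number $p^{(a)}_i$. The KKR map $\phi$ from highest paths to rigged configurations is defined by induction on $L$. For $L=0$ the image is empty. Given $\phi(b_1\ldots b_L)$ and $d=b_{L+1}$: if $d=1$, the strings are unchanged (only $L$ is replaced by $L+1$). If $d\ge2$, set $\ell^{(d)}=\infty$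 and for $c=d-1,\ldots,1$ in this order select a color $c$ singular string (with respect to the old configuration and $L$) whose length $\ell^{(c)}$ is largest subject to $\ell^{(c)}\le\ell^{(c+1)}$ (any one if several; if none, $\ell^{(c)}=0$). For each $c=1,\ldots,d-1$ replace the selected string by a color $c$ string of length $\ell^{(c)}+1$ (a new length $1$ string if $\ell^{(c)}=0$), with rigging making it singular with respect to the new configuration and $L+1$; other strings are unchanged. One knows $\phi({\mathcal P}_+(\mu))\subseteq\mathrm{RC}(\mu)$. Let $\tilde{\mathcal J}(\mu)$ be the set of integer arrays $(r^{(a)}_{i,\alpha})_{(a,i)\in\overline H,\alpha\in{\mathbb Z}}$ with $r^{(a)}_{i,\alpha}\le r^{(a)}_{i,\alpha+1}$ and $r^{(a)}_{i,\alpha+m^{(a)}_i}=r^{(a)}_{i,\alpha}+p^{(a)}_i$. Let $\iota:{\mathcal P}_+(\mu)\to\tilde{\mathcal J}(\mu)$ send $p_+$ with $\phi(p_+)=(\mu,{\bf r})$ to the unique quasi-periodic extension of ${\bf r}$ in $\tilde{\mathcal J}(\mu)$. Let ${\mathcal T}$ be the abelian group generated by all $T^{(a)}_l$ ($1\le a\le n$, $l\ge1$) and ${\mathcal A}$ the free abelian group generated by symbols $s^{(a)}_i$, $(a,i)\in\overline H$. They act (commutatively) on $\tilde{\mathcal J}(\mu)$ by $T^{(a)}_l:(r^{(b)}_{j,\beta})\mapsto(r^{(b)}_{j,\beta}+\delta_{ab}\min(l,l^{(b)}_j))$ and $s^{(a)}_i:(r^{(b)}_{j,\beta})\mapsto(r^{(b)}_{j,\beta+\delta_{ab}\delta_{ij}}+C_{ab}\min(l^{(a)}_i,l^{(b)}_j))$.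 Put ${\mathcal J}(\mu)=\tilde{\mathcal J}(\mu)/{\mathcal A}$ (set of ${\mathcal A}$-orbits), on which ${\mathcal T}$ acts. Linearization Conjecture: for every $\mu$ with $p^{(a)}_i\ge1$ for all $(a,i)\in\overline H$: (1) $T^{(r)}_l({\mathcal P}(\mu))={\mathcal P}(\mu)$ for all $r,l$ (so ${\mathcal T}$ acts on ${\mathcal P}(\mu)$); (2) every ${\mathcal T}$-orbit $\Sigma(p)$, $p\in{\mathcal P}(\mu)$, meets ${\mathcal P}_+(\mu)$; (3) the map $\Phi:{\mathcal P}(\mu)\to{\mathcal J}(\mu)$, $\Phi(p)={\mathcal A}\cdot(t\cdot\iota(p_+))$ whenever $p=t\cdot p_+$ with $t\in{\mathcal T}$, $p_+\in{\mathcal P}_+(\mu)$, is well-defined, bijective and commutes with ${\mathcal T}$. For $m\ge1,p\ge0$ let $\Lambda(m,p)$ be the set of integer sequences $(\lambda_\alpha)_{\alpha\in{\mathbb Z}}$ with $\lambda_1=0$, $\lambda_\alpha\le\lambda_{\alpha+1}$, $\lambda_{\alpha+m}=\lambda_\alpha+p$; for a common divisor $\gamma$ of $m,p$ let $\Lambda_\gamma(m,p)$ be the set of $\lambda\in\Lambda(m/\gamma,p/\gamma)$ with $\lambda\notin\Lambda(m/\gamma',p/\gamma')$ for every common divisor $\gamma'>\gamma$ of $m,p$. Identify $\tilde{\mathcal J}(\mu)$ with $X={\mathbb Z}^g\times\prod_{(a,i)\in\overline H}\Lambda(m^{(a)}_i,p^{(a)}_i)$ by $(r^{(a)}_{i,\alpha})\leftrightarrow(\omega,\boldsymbol\lambda)$,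 $\omega^{(a)}_i=r^{(a)}_{i,1}$, $\lambda^{(a)}_{i,\alpha}=r^{(a)}_{i,\alpha}-r^{(a)}_{i,1}$, so ${\mathcal J}(\mu)=X/{\mathcal A}$. Put $X_{\boldsymbol\gamma}={\mathbb Z}^g\times\prod_{(a,i)\in\overline H}\Lambda_{\gamma^{(a)}_i}(m^{(a)}_i,p^{(a)}_i)$ (stable under ${\mathcal T}$ and ${\mathcal A}$) and ${\mathcal P}_{\boldsymbol\gamma}(\mu)=\Phi^{-1}(X_{\boldsymbol\gamma}/{\mathcal A})$. The group ${\mathcal T}$ acts on ${\mathbb Z}^g/F_{\boldsymbol\gamma}{\mathbb Z}^g$ by $T^{(r)}_l({\mathcal I})={\mathcal I}+h^{(r)}_l$. For $x=(\omega,\boldsymbol\lambda)\in X_{\boldsymbol\gamma}$ let $\chi:{\mathcal T}\cdot({\mathcal A}\cdot x)\to{\mathbb Z}^g/F_{\boldsymbol\gamma}{\mathbb Z}^g$, $t\cdot({\mathcal A}\cdot x)\mapsto t\cdot\omega \bmod F_{\boldsymbol\gamma}{\mathbb Z}^g$, where $T^{(r)}_l\cdot\omega=\omega+h^{(r)}_l$ (this is a known well-defined map). Torus Conjecture: for every such $\mu$ and any $p\in{\mathcal P}_{\boldsymbol\gamma}(\mu)$, with $x$ chosen so that $\Phi(p)={\mathcal A}\cdot x$, the map $\chi\circ\Phi$ is a bijection $\Sigma(p)\to{\mathbb Z}^g/F_{\boldsymbol\gamma}{\mathbb Z}^g$ commuting with ${\mathcal T}$. *)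

(* Defs.v *)
From HB Require Import structures.
From mathcomp Require Import all_boot all_order all_algebra.
From mathcomp Require Import boolp classical_sets functions.

Set Implicit Arguments.
Unset Strict Implicit.
Unset Printing Implicit Defensive.

Import Order.TTheory GRing.Theory Num.Theory.

Local Open Scope classical_set_scope.
Local Open Scope nat_scope.

Definition smallest_positive (Q : nat -> Prop) (N : nat) : Prop :=
  [/\ 0 < N, Q N & forall M, 0 < M -> Q M -> N <= M].

(* When no entry of [s] is 0, such an N exists; for [s = [::]] it is 1. *)
Definition LCM (s : seq rat) : nat :=
  xget 0 [set N | smallest_positive
    (fun M => forall q, q \in s -> exists z : int, M%:R = q * z%:~R)%R N].

(* A tableau is the list of its rows, from top to bottom. *)
Definition tableau := seq (seq nat).

(* The list of columns of a tableau; [conjugate] is an involution on arrays of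
   partition shape. *)
Definition conjugate (T : tableau) : tableau :=
  [seq [seq nth 0 u j | u <- T & j < size u] | j <- iota 0 (size (head [::] T))].

(* [before x y] decides whether x may bump y. The lines of a tableau increase,
   so the first such y is the smallest one. *)
Fixpoint insert (before : rel nat) (x : nat) (T : tableau) : tableau :=
  if T is u :: T' then
    let i := find (before x) u in
    if i < size u then set_nth 0 u i x :: insert before (nth 0 u i) T'
    else rcons u x :: T'
  else [:: [:: x]].

(* T <- x *)
Definition row_insert (T : tableau) (x : nat) : tableau := insert ltn x T.
(* x -> T *)
Definition col_insert (x : nat) (T : tableau) : tableau :=
  conjugate (insert leq x (conjugate T)).

(* Words in the generators T^(a)_l and their inverses (flag [true] for the
   inverse) represent the elements of the abelian group they generate; the
   T^(a)_l commute, so the action of a word depends only on its class. *)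
Definition word := seq (bool * (nat * nat)).

Definition act (X : Type) (T Tinv : nat -> nat -> X -> X) (t : word) (x : X) : X :=
  foldr (fun g y => (if g.1 then Tinv else T) g.2.1 g.2.2 y) x t.

Section Crystals.
Variable n : nat.

Definition letter (a : nat) : bool := 1 <= a <= n.+1.

(* The generators have 1 <= a <= n and l >= 1. *)
Definition time_index (a l : nat) : bool := (1 <= a <= n) && (1 <= l).

Definition time_word (t : word) : bool := all (fun g => time_index g.2.1 g.2.2) t.

(* B^{r,l} *)
Definition rect (r l : nat) (T : tableau) : bool :=
  [&& size T == r, all (fun u => size u == l) T, all (all letter) T,
      all (sorted leq) T & all (sorted ltn) (conjugate T)].

(* [combR r l b c] is the pair (c', b') with R(b (x) c) = c' (x) b'. *)
Definition combR (r l : nat) (b : tableau) (c : nat) : nat * tableau :=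
  xget (c, b) [set x | [/\ letter x.1, rect r l x.2
                         & col_insert c b = row_insert x.2 x.1]].

(* The only other shape that occurs is (l^r, 1). *)
Definition local_energy (r l : nat) (b : tableau) (c : nat) : nat :=
  if shape (col_insert c b) == l.+1 :: nseq r.-1 l then 0 else 1.

(* v'(v;p), p'(v;p) and the list of the e_k(v;p) *)
Fixpoint carrier_out (r l : nat) (v : tableau) (p : seq nat) : tableau :=
  if p is b :: p' then carrier_out r l (combR r l v b).2 p' else v.

Fixpoint path_out (r l : nat) (v : tableau) (p : seq nat) : seq nat :=
  if p is b :: p' then
    (combR r l v b).1 :: path_out r l (combR r l v b).2 p'
  else [::].

Fixpoint energies (r l : nat) (v : tableau) (p : seq nat) : seq nat :=
  if p is b :: p' then
    local_energy r l v b :: energies r l (combR r l v b).2 p'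
  else [::].

Definition periodic_carriers (r l : nat) (p : seq nat) : set tableau :=
  [set v | rect r l v /\ carrier_out r l v p = v].

Definition evolvable_by (r l : nat) (p : seq nat) : Prop :=
  (exists v, periodic_carriers r l p v) /\
  (forall v w, periodic_carriers r l p v -> periodic_carriers r l p w ->
     path_out r l v p = path_out r l w p /\ energies r l v p = energies r l w p).

Definition evolvable (p : seq nat) : Prop :=
  forall r l, time_index r l -> evolvable_by r l p.

(* T^(r)_l(p) and E^(r)_l(p), meaningful when p is T^(r)_l-evolvable *)
Definition evol (r l : nat) (p : seq nat) : seq nat :=
  path_out r l (xget [::] (periodic_carriers r l p)) p.

Definition energy (r l : nat) (p : seq nat) : nat :=
  sumn (energies r l (xget [::] (periodic_carriers r l p)) p).

Definition is_path (L : nat) (p : seq nat) : bool := (size p == L) && all letter p.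

Definition dominant (p : seq nat) : Prop :=
  forall a, 1 <= a <= n -> count_mem a.+1 p <= count_mem a p.

Definition highest (p : seq nat) : Prop :=
  forall j, 1 <= j <= size p -> dominant (take j p).

End Crystals.

Definition cartan (a b : nat) : int :=
  ((a == b)%:Z *+ 2 - (a == b.+1)%:Z - (a.+1 == b)%:Z)%R.

(* (color, length, rigging) *)
Definition rstring := (nat * nat * int)%type.

(* vacancy number of the rows of length l and color a in the configuration
   underlying [C], for paths of length L *)
Definition vac (C : seq rstring) (L a l : nat) : int :=
  ((a == 1%N)%:Z * L%:Z - \sum_(s <- C) cartan a s.1.1 * (minn l s.1.2)%:Z)%R.

Definition singular (C : seq rstring) (L : nat) (s : rstring) : bool :=
  s.2 == vac C L s.1.1 s.1.2.

(* The pairs (c', l^(c')) for c' = c, ..., 1; the bound [None] is infinity. *)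
Fixpoint select (C : seq rstring) (L : nat) (bound : option nat) (c : nat) :
    seq (nat * nat) :=
  if c is c'.+1 then
    let k := \max_(s <- C | [&& s.1.1 == c, singular C L s
                & if bound is Some m then s.1.2 <= m else true]) s.1.2 in
    (c, k) :: select C L (Some k) c'
  else [::].

(* Every string has positive length, so [rem] does nothing when l^(c) = 0. *)
Definition kkr_step (st : nat * seq rstring) (d : nat) : nat * seq rstring :=
  let: (L, C) := st in
  let sel := select C L None d.-1 in
  let kept := foldl (fun K ck => rem (ck.1, ck.2, vac C L ck.1 ck.2) K) C sel in
  let new := kept ++ [seq (ck.1, ck.2.+1, 0%R) | ck <- sel] in
  (L.+1, kept ++ [seq (ck.1, ck.2.+1, vac new L.+1 ck.1 ck.2.+1) | ck <- sel]).

Definition kkr (p : seq nat) : seq rstring := (foldl kkr_step (0, [::]) p).2.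

(* A Young diagram is the list of its row lengths. *)
Definition young (s : seq nat) : bool := sorted geq s && (0 \notin s).

(* The sequences indexed by the integers forming Lambda(m, p) *)
Definition Lambda (m : nat) (p : int) : set (int -> int) :=
  [set f | f 1%R = 0%R /\
     forall k, (f k <= f (k + 1) /\ f (k + m%:Z) = f k + p)%R].

Definition common_divisor (c m : nat) (p : int) : bool :=
  (c %| m) && (c%:Z %| p)%Z.

Definition Lambda_gamma (c m : nat) (p : int) : set (int -> int) :=
  [set f | Lambda (m %/ c) (p %/ c%:Z)%Z f /\
     forall c', common_divisor c' m p -> c < c' ->
       ~ Lambda (m %/ c') (p %/ c'%:Z)%Z f].

Section TorusData.
Variables (n L : nat) (mu : 'I_n -> seq nat).

(* The diagram mu^(a) is [mu] at the ordinal of value a - 1. *)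
Definition Hbar : finType := {a : 'I_n & 'I_(size (undup (mu a)))}.

Definition color (x : Hbar) : nat := (tag x).+1.
Definition len (x : Hbar) : nat := nth 0 (undup (mu (tag x))) (tagged x).
Definition mult (x : Hbar) : nat := count_mem (len x) (mu (tag x)).

Definition cmin (x y : Hbar) : int :=
  (cartan (color x) (color y) * (minn (len x) (len y))%:Z)%R.

Definition vacancy (x : Hbar) : int :=
  ((color x == 1%N)%:Z * L%:Z - \sum_(y : Hbar) cmin x y * (mult y)%:Z)%R.

Definition hvec (r l : nat) (y : Hbar) : int :=
  ((color y == r)%:Z * (minn l (len y))%:Z)%R.

(* Vectors and matrices are indexed by [Hbar] through its enumeration. *)
Definition gdim : nat := #|Hbar|.

Definition Fentry (x y : Hbar) : int :=
  ((x == y)%:Z * vacancy x + cmin x y * (mult y)%:Z)%R.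

Definition Fmx : 'M[int]_gdim :=
  \matrix_(i, j) Fentry (enum_val i) (enum_val j).

(* The division is exact when each gamma_y divides mult y and vacancy y. *)
Definition Fgamma (gamma : Hbar -> nat) : 'M[int]_gdim :=
  \matrix_(i, j) (Fentry (enum_val i) (enum_val j) %/ (gamma (enum_val j))%:Z)%Z.

Definition hcol (r l : nat) : 'cV[int]_gdim := \col_i hvec r l (enum_val i).

Definition replace_col (A : 'M[int]_gdim) (j0 : 'I_gdim) (v : 'cV[int]_gdim) :
    'M[int]_gdim :=
  \matrix_(i, j) if j == j0 then v i 0%R else A i j.

(* P(mu) and P_+(mu) *)
Definition Pmu : set (seq nat) :=
  [set p | [/\ is_path n L p, evolvable n p, dominant n p
    & forall a l, time_index n a l ->
        energy n a l p = \sum_(x : Hbar | color x == a) minn l (len x) * mult x]].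

Definition Pplus : set (seq nat) := [set p | Pmu p /\ highest n p].

Definition riggings := Hbar -> int -> int.

Definition Jtilde : set riggings :=
  [set rho | forall x k,
     (rho x k <= rho x (k + 1) /\ rho x (k + (mult x)%:Z) = rho x k + vacancy x)%R].

(* The strings with the riggings r_{i,1}, ..., r_{i,m_i} *)
Definition strings (rho : riggings) : seq rstring :=
  flatten [seq [seq (color x, len x, rho x k%:Z%R) | k <- iota 1 (mult x)]
          | x <- enum Hbar].

(* The last clause is 0 <= r_{i,1} and r_{i,m_i} <= p_i; monotonicity is in
   [Jtilde]. Strings form multisets, hence [perm_eq]. *)
Definition iota_rel (p : seq nat) (rho : riggings) : Prop :=
  [/\ Jtilde rho, perm_eq (kkr p) (strings rho)
    & forall x, (0 <= rho x 1 /\ rho x (mult x)%:Z <= vacancy x)%R].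

Definition iotaJ (p : seq nat) : riggings :=
  xget (fun _ _ => 0%R) [set rho | iota_rel p rho].

Definition evolJ (r l : nat) (rho : riggings) : riggings :=
  fun y k => (rho y k + hvec r l y)%R.
Definition evolJ_inv (r l : nat) (rho : riggings) : riggings :=
  fun y k => (rho y k - hvec r l y)%R.
Definition actJ : word -> riggings -> riggings := act evolJ evolJ_inv.

(* The action of the product over x of the (s_x)^(z x). *)
Definition slide (z : Hbar -> int) (rho : riggings) : riggings :=
  fun y k => (rho y (k + z y) + \sum_(x : Hbar) z x * cmin x y)%R.

Definition Aorbit (rho : riggings) : set riggings :=
  [set slide z rho | z in [set: Hbar -> int]].

(* J(mu) *)
Definition Jmu : set (set riggings) := [set Aorbit rho | rho in Jtilde].

(* The inverse is taken in P(mu), on which T^(r)_l is to be a bijection. *)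
Definition evol_inv (r l : nat) (q : seq nat) : seq nat :=
  xget q [set p | Pmu p /\ evol n r l p = q].
Definition actP : word -> seq nat -> seq nat := act (evol n) evol_inv.

(* Sigma(p) *)
Definition orbitP (p : seq nat) : set (seq nat) :=
  [set actP t p | t in [set t | time_word n t]].

(* Phi, meaningful under parts (2) and (3) of the Linearization Conjecture *)
Definition Phi (p : seq nat) : set riggings :=
  xget set0 [set O | exists t p0, [/\ time_word n t, Pplus p0, p = actP t p0
                                    & O = Aorbit (actJ t (iotaJ p0))]].

(* X_gamma, as a subset of J~(mu): the sequences lambda are obtained from the
   riggings by subtracting omega = (r_{i,1}). *)
Definition Xgamma (gamma : Hbar -> nat) : set riggings :=
  [set rho | Jtilde rho /\ forall x,
     Lambda_gamma (gamma x) (mult x) (vacancy x) (fun k => rho x k - rho x 1)%R].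

Definition omega (rho : riggings) : 'cV[int]_gdim := \col_i rho (enum_val i) 1%R.

Definition Pgamma (gamma : Hbar -> nat) : set (seq nat) :=
  [set p | Pmu p /\ exists2 rho, Xgamma gamma rho & Phi p = Aorbit rho].

Definition actZ : word -> 'cV[int]_gdim -> 'cV[int]_gdim :=
  act (fun r l w => w + hcol r l)%R (fun r l w => w - hcol r l)%R.

Definition coset (gamma : Hbar -> nat) (w : 'cV[int]_gdim) : set 'cV[int]_gdim :=
  [set (w + Fgamma gamma *m z)%R | z in [set: 'cV[int]_gdim]].

(* Z^g / F_gamma Z^g *)
Definition torus (gamma : Hbar -> nat) : set (set 'cV[int]_gdim) :=
  range (coset gamma).

Definition chi (gamma : Hbar -> nat) (rho : riggings) (O : set riggings) :
    set 'cV[int]_gdim :=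
  xget set0 [set C | exists t, [/\ time_word n t, O = [set actJ t y | y in Aorbit rho]
                                 & C = coset gamma (actZ t (omega rho))]].

Definition positive_vacancies : Prop := forall x, (1 <= vacancy x)%R.

Definition common_divisors (gamma : Hbar -> nat) : Prop :=
  forall x, common_divisor (gamma x) (mult x) (vacancy x).

End TorusData.

Arguments iotaJ {n} L mu p _ _.
Arguments Jtilde {n} L mu _.
Arguments Jmu {n} L mu _.
Arguments Phi {n} L mu p _.

Definition linearization_conjecture (n L : nat) : Prop :=
  forall mu : 'I_n -> seq nat, (forall a, young (mu a)) ->
  positive_vacancies L mu ->
  [/\ forall r l, time_index n r l -> [set evol n r l p | p in Pmu L mu] = Pmu L mu,
      forall p, Pmu L mu p -> exists2 q, orbitP L mu p q & Pplus L mu q,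
      forall t t' p p', time_word n t -> time_word n t' ->
        Pplus L mu p -> Pplus L mu p' -> actP L mu t p = actP L mu t' p' ->
        Aorbit (actJ t (iotaJ L mu p)) = Aorbit (actJ t' (iotaJ L mu p')),
      set_bij (Pmu L mu) (Jmu L mu) (Phi L mu)
    & forall t p, time_word n t -> Pmu L mu p ->
        Phi L mu (actP L mu t p) = [set actJ t rho | rho in Phi L mu p]].

Definition torus_conjecture (n L : nat) : Prop :=
  forall (mu : 'I_n -> seq nat) (gamma : Hbar mu -> nat) (p : seq nat)
    (rho : riggings mu),
  (forall a, young (mu a)) -> positive_vacancies L mu ->
  common_divisors L gamma -> Pgamma L gamma p ->
  Xgamma L gamma rho -> Phi L mu p = Aorbit rho ->
  set_bij (orbitP L mu p) (torus L gamma) (chi L gamma rho \o Phi L mu) /\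
  (forall t q, time_word n t -> orbitP L mu p q ->
     chi L gamma rho (Phi L mu (actP L mu t q)) =
     [set actZ t w | w in chi L gamma rho (Phi L mu q)]).

(* Main.v *)
Require Import Defs.
From mathcomp Require Import all_boot all_order all_algebra.
From mathcomp Require Import boolp classical_sets functions.
From mathcomp Require Import ring.

(** The Torus Conjecture carries [T^(r)_l] on the orbit of [p] to translation
    by [h] on [Z^g / F_gamma Z^g], so [(T^(r)_l)^M p = p] iff [M h] lies in
    [F_gamma Z^g]. By Cramer's rule this means that
    [M det F_gamma[bj] / det F_gamma] is an integer for all [(b,j)], provided
    [det F_gamma <> 0]. The latter holds because [F] is a positive diagonal
    matrix plus a Gram matrix, multiplied by a positive diagonal matrix. *)

Set Implicit Arguments.
Unset Strict Implicit.
Unset Printing Implicit Defensive.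

Import Order.TTheory GRing.Theory Num.Theory.

Local Open Scope ring_scope.

(** * Gram representations of the minimum and of the Cartan matrix *)

Lemma sum_indicatorM (K i j : nat) : (i < K)%N ->
  \sum_(k < K) (k == i :> nat)%:Z * (k == j :> nat)%:Z = (i == j)%:Z.
Proof.
move=> iK; rewrite (bigD1 (Ordinal iK)) //= eqxx mul1r big1 ?addr0 // => k.
by rewrite -val_eqE /= => /negPf ->; rewrite mul0r.
Qed.

(** [minn a b] counts the [k] lying below both [a] and [b], so it is the inner product of two
    indicator vectors. *)
Lemma minn_gram (K a b : nat) : (a <= K)%N ->
  (minn a b)%:Z = \sum_(k < K) (k < a)%:Z * (k < b)%:Z.
Proof.
move=> aK.
rewrite (eq_bigr (fun k : 'I_K => (k < minn a b)%:Z)); last first.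
  by move=> k _; rewrite leq_min; do 2 case: (k < _)%N.
rewrite -(big_mkord xpredT (fun k => (k < minn a b)%:Z)).
have mK : (minn a b <= K)%N by rewrite geq_min aK.
rewrite (big_cat_nat (n := minn a b)) //= [X in _ + X]big_nat_cond.
rewrite [X in _ + X]big1 ?addr0 => [|k /andP[/andP[ak _] _]]; last first.
  by rewrite ltnNge ak.
rewrite big_nat_cond (eq_bigr (fun=> 1)) => [|k /andP[/andP[_ ->]]//].
by rewrite -big_nat_cond sumr_const_nat subn0 pmulrn intz.
Qed.

(* The Cartan matrix of [A_n] is the Gram matrix of the vectors
   [eps_a - eps_(a+1)]. *)
Lemma cartan_gram (K a b : nat) : (a.+1 < K)%N -> (b.+1 < K)%N ->
  cartan a b = \sum_(i < K) ((i == a :> nat)%:Z - (i == a.+1 :> nat)%:Z) *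
                            ((i == b :> nat)%:Z - (i == b.+1 :> nat)%:Z).
Proof.
move=> aK bK; have aK' := ltnW aK.
under eq_bigr do rewrite mulrBl !mulrBr opprB.
rewrite !big_split /= !sumrN !sum_indicatorM // /cartan eqSS.
by rewrite mulr2n; ring.
Qed.

(** * Nonvanishing of the determinant of [Fmx] *)

Section Nondegeneracy.
Variables (n L : nat) (mu : 'I_n -> seq nat).
Implicit Types x y : Hbar mu.

Lemma mult_gt0 x : (0 < mult x)%N.
Proof. by rewrite -has_count has_pred1 -mem_undup mem_nth. Qed.

Lemma cmin_gram : exists (I : finType) (e : I -> Hbar mu -> int),
  forall x y, cmin x y = \sum_i e i x * e i y.
Proof.
pose K := \max_(x : Hbar mu) len x.
(* The tensor product of the two Gram vectors. Colors run over 1, ..., n and [(color x).+1] must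
   also be an index, hence [n.+2]; [K] bounds all lengths. *)
exists ('I_n.+2 * 'I_K)%type, (fun (i : 'I_n.+2 * 'I_K) x =>
  ((i.1 == color x :> nat)%:Z - (i.1 == (color x).+1 :> nat)%:Z)
  * (i.2 < len x)%:Z) => x y.
have colorP (z : Hbar mu) : ((color z).+1 < n.+2)%N := ltn_ord (tag z).
rewrite /cmin (cartan_gram (colorP x) (colorP y)).
rewrite (@minn_gram K) ?leq_bigmax // mulr_suml.
under eq_bigr do rewrite mulr_sumr.
by rewrite pair_bigA; apply: eq_bigr => i _; rewrite mulrACA.
Qed.

Lemma cmin_form_ge0 (R : realDomainType) (v : Hbar mu -> R) :
  0 <= \sum_x \sum_y v x * (cmin x y)%:~R * v y.
Proof.
have [I [e eE]] := cmin_gram.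
suff -> : \sum_x \sum_y v x * (cmin x y)%:~R * v y
    = \sum_i (\sum_x v x * (e i x)%:~R) ^+ 2.
  by apply: sumr_ge0 => i _; apply: sqr_ge0.
under [RHS]eq_bigr do rewrite expr2 mulr_suml.
rewrite [RHS]exchange_big /=; apply: eq_bigr => x _.
under [RHS]eq_bigr do rewrite mulr_sumr.
rewrite [RHS]exchange_big /=; apply: eq_bigr => y _.
rewrite eE rmorph_sum mulr_sumr mulr_suml; apply: eq_bigr => i _.
by rewrite rmorphM /=; ring.
Qed.

(** Let [u] be a nonzero left null vector. Dividing column [y] of [u F = 0] by [mult y], multiplying
    by [u y] and summing shows that the sum of [u y ^+ 2 * vacancy y / mult y] is minus the form of
    [cmin], hence at most 0; but it is positive. *)
Lemma det_Fmx_neq0 : positive_vacancies L mu -> \det (Fmx L mu) != 0.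
Proof.
move=> vac_ge1; rewrite -(intr_eq0 rat) -det_map_mx.
apply/det0P => -[v v0 vF0].
pose u x := v 0 (enum_rank x).
have uF y : u y * (vacancy L y)%:~R
    + (\sum_x u x * (cmin x y)%:~R) * (mult y)%:R = 0 :> rat.
  transitivity ((v *m map_mx intr (Fmx L mu)) 0 (enum_rank y)); last first.
    by rewrite vF0 mxE.
  rewrite mxE (reindex (@enum_rank (Hbar mu))) /=; last first.
    exact/onW_bij/enum_rank_bij.
  transitivity (\sum_x (u x * ((x == y)%:Z%:~R * (vacancy L x)%:~R)
      + u x * (cmin x y)%:~R * (mult y)%:R)); last first.
    apply: eq_bigr => x _; rewrite !mxE !enum_rankK -mulrA -mulrDr.
    by rewrite [in RHS]intrD [in RHS]intrM [(cmin x y * _)%:~R]intrM.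
  rewrite big_split mulr_suml [X in _ = X + _](bigD1 y) //= eqxx mul1r.
  by rewrite [X in _ + X + _]big1 ?addr0 // => x /negPf ->; rewrite mul0r mulr0.
have [y uy0] : exists y, u y != 0.
  have [j vj0] : exists j, v 0 j != 0 by apply/rV0Pn.
  by exists (enum_val j); rewrite /u enum_valK.
have mP (z : Hbar mu) : 0 < (mult z)%:R :> rat.
  by rewrite ltr0n; apply: mult_gt0.
have vP (z : Hbar mu) : 0 < (vacancy L z)%:~R :> rat.
  by rewrite ltr0z (lt_le_trans _ (vac_ge1 z)).
have diag_ge0 z : 0 <= u z ^+ 2 * ((vacancy L z)%:~R / (mult z)%:R).
  by rewrite mulr_ge0 ?sqr_ge0 ?divr_ge0 ?ltW.
suff : \sum_z u z ^+ 2 * ((vacancy L z)%:~R / (mult z)%:R) <= 0.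
  apply/negP; rewrite -ltNge (bigD1 y) //= ltr_pwDl ?sumr_ge0 //.
  by rewrite mulr_gt0 ?divr_gt0 // lt_def sqr_ge0 sqrf_eq0 uy0.
rewrite -oppr_ge0 -sumrN; have := cmin_form_ge0 u.
rewrite exchange_big /=; congr (0 <= _); apply: eq_bigr => z _.
rewrite -mulr_suml; have mz0 := lt0r_neq0 (mP z).
apply: (mulIf mz0); rewrite mulrAC -(addr0_eq (uF z)).
by field.
Qed.

End Nondegeneracy.

(** * Cramer's rule over the integers *)

Section Cramer.
Variables (n L : nat) (mu : 'I_n -> seq nat).
Implicit Types (A : 'M[int]_(gdim mu)) (b : 'cV[int]_(gdim mu)).

(** Expand along column [j]: its cofactors do not see that column, so they are those of [A]. *)
Lemma det_replace_col A j b : \det (replace_col A j b) = (\adj A *m b) j 0.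
Proof.
rewrite (expand_det_col _ j) mxE; apply: eq_bigr => i _.
rewrite !mxE eqxx mulrC; congr (_ * _).
rewrite /cofactor; congr (_ * \det _); apply/matrixP => i' j'.
by rewrite !mxE eq_sym (negPf (neq_lift _ _)).
Qed.

(** Multiplying [A z = b] by the adjugate gives one direction. Conversely the quotients form [z],
    and [A] times its adjugate gives [b] after cancelling [\det A]. *)
Lemma mulmx_solvableP A b : \det A != 0 ->
  (exists z, A *m z = b) <->
  (forall j, exists z : int, \det (replace_col A j b) = \det A * z).
Proof.
move=> A0; split=> [[z <-] j|/choice[z zE]].
  by exists (z j 0); rewrite det_replace_col mulmxA mul_adj_mx mul_scalar_mx mxE.
exists (\col_j z j).
suff /colP E : \det A *: (A *m \col_j z j) = \det A *: b.
  apply/colP => i; apply: (mulfI A0).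
  by move: (E i); rewrite mxE [in RHS]mxE.
rewrite scalemxAr -[RHS]mul_scalar_mx -mul_mx_adj -mulmxA.
congr (A *m _); apply/colP => j.
by rewrite -det_replace_col zE !mxE.
Qed.

Lemma replace_colZ A j b (c : int) :
  \det (replace_col A j (c *: b)) = c * \det (replace_col A j b).
Proof. by rewrite !det_replace_col -scalemxAr mxE. Qed.

End Cramer.

(** * From [Fmx] to [Fgamma], and from periods to lattice membership *)

Section Periods.
Variables (n L : nat) (mu : 'I_n -> seq nat) (gamma : Hbar mu -> nat).
Hypothesis (vac_ge1 : positive_vacancies L mu).
Hypothesis (gammaP : common_divisors L gamma).

Lemma gamma_gt0 x : (0 < gamma x)%N.
Proof.
have /andP[] := gammaP x; case: (gamma x) => // /dvdnP[k].
by rewrite muln0; have := mult_gt0 x; case: (mult x).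
Qed.

(** The divisions in [Fgamma] are exact: [gamma y] divides [mult y], and the vacancy number in the
    diagonal entry. *)
Lemma Fgamma_diag :
  Fmx L mu = Fgamma L gamma *m diag_mx (\row_j (gamma (enum_val j))%:Z).
Proof.
apply/matrixP => i j; rewrite mul_mx_diag !mxE divzK // /Fentry.
have /andP[gm gp] := gammaP (enum_val j).
rewrite rpredD ?[(_ %| cmin _ _ * _)%Z]dvdz_mull //.
by case: eqP => [->|_]; rewrite ?mul1r // mul0r dvdz0.
Qed.

Lemma det_Fmx :
  \det (Fmx L mu) = \det (Fgamma L gamma) * \prod_(j < gdim mu) (gamma (enum_val j))%:Z.
Proof.
rewrite Fgamma_diag det_mulmx det_diag; congr (_ * _).
by apply: eq_bigr => j _; rewrite mxE.
Qed.

(** The inserted column is not rescaled, so the diagonal factor at [j] is 1; the extra [gamma] on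
    the left completes the product. *)
Lemma det_replace_col_Fmx j h :
  (gamma (enum_val j))%:Z * \det (replace_col (Fmx L mu) j h)
  = \det (replace_col (Fgamma L gamma) j h) * \prod_(k < gdim mu) (gamma (enum_val k))%:Z.
Proof.
have -> : replace_col (Fmx L mu) j h = replace_col (Fgamma L gamma) j h
    *m diag_mx (\row_k if k == j then 1 else (gamma (enum_val k))%:Z).
  apply/matrixP => i k; rewrite mul_mx_diag !mxE; case: eqP => _.
    by rewrite mulr1.
  by have /matrixP/(_ i k) := Fgamma_diag; rewrite mul_mx_diag !mxE.
rewrite det_mulmx det_diag mulrCA; congr (_ * _).
rewrite [RHS](bigD1 j) // [in LHS](bigD1 j) //= mxE eqxx mul1r; congr (_ * _).
by apply: eq_bigr => k /negPf kj; rewrite mxE kj.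
Qed.

Lemma prod_gamma_neq0 : \prod_(j < gdim mu) (gamma (enum_val j))%:Z != 0.
Proof. by apply/prodf_neq0 => j _; rewrite -lt0n gamma_gt0. Qed.

Lemma det_Fgamma_neq0 : \det (Fgamma L gamma) != 0.
Proof.
by have := det_Fmx_neq0 vac_ge1; rewrite det_Fmx mulf_eq0 negb_or => /andP[].
Qed.

Lemma det_replace_col_Fgamma_eq0 j h :
  (\det (replace_col (Fgamma L gamma) j h) == 0)
  = (\det (replace_col (Fmx L mu) j h) == 0).
Proof.
have /(congr1 (eq_op^~ 0)) := det_replace_col_Fmx j h.
rewrite !mulf_eq0 (negPf prod_gamma_neq0) orbF => <-.
by rewrite eqz_nat eqn0Ngt gamma_gt0.
Qed.

Lemma ratio_det j h :
  (\det (Fgamma L gamma))%:~R / (\det (replace_col (Fgamma L gamma) j h))%:~R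
  = (\det (Fmx L mu))%:~R
    / ((gamma (enum_val j))%:R * (\det (replace_col (Fmx L mu) j h))%:~R) :> rat.
Proof.
rewrite [_%:R]pmulrn -intrM det_replace_col_Fmx det_Fmx !intrM.
by rewrite invfM mulrACA divff ?mulr1 // intr_eq0 prod_gamma_neq0.
Qed.

Lemma coset_translate (w v : 'cV[int]_(gdim mu)) :
  [set u + v | u in coset L gamma w]%classic = coset L gamma w <->
  exists z, Fgamma L gamma *m z = v.
Proof.
split=> [E | [z <-]].
  have : coset L gamma w (w + v).
    by rewrite -E; exists w => //; exists 0 => //; rewrite mulmx0 addr0.
  by case=> z _ /addrI; exists z.
apply/seteqP; split => [_ [_ [y _ <-] <-]|_ [y _ <-]].
  by exists (y + z) => //; rewrite mulmxDr addrA.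
exists (w + Fgamma L gamma *m (y - z)); first by exists (y - z).
by rewrite -addrA -mulmxDr subrK.
Qed.

Lemma lcm_condition r l (M : nat) :
  (forall q : rat, q \in [seq ((\det (Fgamma L gamma))%:~R /
        (\det (replace_col (Fgamma L gamma) j (hcol mu r l)))%:~R)
      | j <- enum 'I_(gdim mu)
      & \det (replace_col (Fmx L mu) j (hcol mu r l)) != 0] ->
    exists z : int, M%:R = q * z%:~R) <->
  exists z, Fgamma L gamma *m z = M%:Z *: hcol mu r l.
Proof.
have D0 := det_Fgamma_neq0.
rewrite mulmx_solvableP //; split => [H j|H q /mapP[j]].
  rewrite replace_colZ.
  (* An index filtered out of the list has a vanishing determinant, and Cramer's condition holds
     there with quotient 0. *)
  have [d0|d0] := boolP (\det (replace_col (Fmx L mu) j (hcol mu r l)) == 0).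
    rewrite -det_replace_col_Fgamma_eq0 in d0.
    by exists 0; rewrite (eqP d0) !mulr0.
  have [|z zE] := H ((\det (Fgamma L gamma))%:~R /
        (\det (replace_col (Fgamma L gamma) j (hcol mu r l)))%:~R).
    by apply/mapP; exists j; rewrite // mem_filter d0 mem_enum.
  exists z; apply/eqP; rewrite -(eqr_int rat) !intrM.
  rewrite -det_replace_col_Fgamma_eq0 -(intr_eq0 rat) in d0.
  by rewrite -[_%:~R]/(M%:R) zE mulrAC mulfVK.
rewrite mem_filter -det_replace_col_Fgamma_eq0 => /andP[d0 _] ->.
have [z] := H j; rewrite replace_colZ => /(congr1 (intr : int -> rat)).
rewrite -(intr_eq0 rat) in d0.
rewrite !intrM => zE; exists z.
by apply: (mulIf d0); rewrite -[M%:R]/(M%:Z%:~R) zE mulrAC mulfVK.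
Qed.

(** Equivariance of [chi \o Phi] turns [M] time steps into translation by [M] times [hcol];
    injectivity on the orbit brings equality of cosets back to paths. *)
Lemma iter_evol_fixedP r l p (M : nat) :
  (forall a, young (mu a)) -> torus_conjecture n L ->
  time_index n r l -> Pgamma L gamma p ->
  iter M (evol n r l) p = p <->
  exists z, Fgamma L gamma *m z = M%:Z *: hcol mu r l.
Proof.
move=> young_mu torusC rl pP.
have [_ [rho rhoX PhiE]] := pP.
have [[ftorus finj _] fact] :=
  torusC mu gamma p rho young_mu vac_ge1 gammaP pP rhoX PhiE.
pose t : word := nseq M (false, (r, l)).
have tw : time_word n t by apply/allP => g /nseqP[-> _].
have actPE : actP L mu t p = iter M (evol n r l) p.
  by rewrite /t; elim: M {t tw} => //= M ->.
have actZE w : actZ t w = w + M%:Z *: hcol mu r l.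
  rewrite /t; elim: M {t tw actPE} => [|M IH]; first by rewrite scale0r addr0.
  by rewrite /actZ /= -/(actZ _ _) IH -addrA -(addn1 M) PoszD scalerDl scale1r.
have p_orb : orbitP L mu p p by exists [::].
have tp_orb : orbitP L mu p (iter M (evol n r l) p) by exists t.
(* Any representative [w] of the coset of [p] will do, since the translations fixing a coset do not
   depend on it. *)
have /= [w _ wE] := ftorus p p_orb.
have := fact t p tw p_orb; rewrite actPE -wE => Ft.
rewrite -(coset_translate w) -(funext actZE) -Ft wE; split => [-> //|].
by apply: finj; rewrite inE.
Qed.

End Periods.

(** One positive common multiple guarantees a least one, so the default value 0 in [LCM] is not
    taken. *)
Lemma smallest_positive_LCM (s : seq rat) (M : nat) : (0 < M)%N ->
  (forall q, q \in s -> exists z : int, M%:R = q * z%:~R) ->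
  smallest_positive
    (fun M => forall q, q \in s -> exists z : int, M%:R = q * z%:~R) (LCM s).
Proof.
move=> M0 MP; rewrite /LCM; apply: xgetPex.
pose P N := `[< (0 < N)%N /\
  forall q, q \in s -> exists z : int, N%:R = q * z%:~R >].
have exP : exists N, P N by exists M; apply/asboolP.
case: (ex_minnP exP) => N /asboolP[N0 NP] Nmin.
by exists N; split => // N' N'0 N'P; apply/Nmin/asboolP.
Qed.

Theorem theorem3p2 (n L : nat) (mu : 'I_n -> seq nat) (gamma : Hbar mu -> nat)
    (r l : nat) (p : seq nat) :
  (1 <= n)%N -> (1 <= L)%N ->
  linearization_conjecture n L -> torus_conjecture n L ->
  (forall a, young (mu a)) -> positive_vacancies L mu ->
  common_divisors L gamma ->
  (1 <= r <= n)%N -> (1 <= l)%N ->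
  Pgamma L gamma p ->
  let F := Fmx L mu in
  let Fg := Fgamma L gamma in
  let h := hcol mu r l in
  let N := LCM [seq ((\det Fg)%:~R / (\det (replace_col Fg j h))%:~R)%R
               | j <- enum 'I_(gdim mu) & (\det (replace_col F j h) != 0)%R] in
  smallest_positive (fun M => iter M (evol n r l) p = p) N /\
  N = LCM [seq ((\det F)%:~R
                  / ((gamma (enum_val j))%:R * (\det (replace_col F j h))%:~R))%R
          | j <- enum 'I_(gdim mu) & (\det (replace_col F j h) != 0)%R].
Proof.
move=> _ _ _ torusC young_mu vac_ge1 gammaP rn l1 pP F Fg h N.
have rl : time_index n r l by apply/andP.
have fixP M := iter_evol_fixedP vac_ge1 gammaP M young_mu torusC rl pP.
have lcmP := lcm_condition vac_ge1 gammaP r l.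
split; last first.
  by congr LCM; apply: eq_map => j; apply: ratio_det.
have D0 := det_Fgamma_neq0 vac_ge1 gammaP.
rewrite /N; set s := [seq _ | _ <- _ & _].
(* The absolute value of [\det Fg] is a positive common multiple: in Cramer's condition the quotient
   is the replaced determinant times the sign of [\det Fg]. *)
have [||N0 /lcmP NP Nmin] := @smallest_positive_LCM s `|\det Fg|%N.
- by rewrite absz_gt0.
- apply/lcmP/mulmx_solvableP => // j; rewrite replace_colZ abszEsg.
  by eexists; rewrite [sgz _ * _]mulrC -mulrA.
split => //; first exact/fixP.
by move=> M M0 /fixP MP; apply: Nmin => //; apply/lcmP.
Qed.
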